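(* Let $S$ be the second filtration of the surjection operad over $\mathbb{F}_2$ (the cacti model described in the context), let $H=H_*(S)\cong H_*(D_2,\mathbb{F}_2)$, let $(\mathcal{F}(W),d)$ be the bigraded model of $H$ as a planar operad, and let $\pi:(\mathcal{F}(W^{\le 1}),d)\to S$ be a morphism of differential graded planar operads, sending each element of $W^0$ to a cycle representing its image under $\rho$ in $H$, such that $$\pi(m)=12,\quad \pi(b)=121+212,\quad \pi(A)=0,\quad \pi(B)=21312+23132+12131+31323 .$$ Let $\alpha\in \mathrm{Hom}_{-1}(W^2,H)$ be the map sending $z\in W^2$ to the homology class of the cycle $\pi(dz)$ in $H_*(S)=H$. Then $\alpha$ is not in the image of $$\partial:\mathrm{Hom}_0(W^1,H)\to \mathrm{Hom}_{-1}(W^2,H),$$ and therefore $\alpha$ represents a non-trivial obstruction to the formality of $S$ (i.e. the class of $\alpha$ in the cokernel of $\partial$, which is the first obstruction to the formality of $S$ as a planar operad, is non-zero).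
   Context: Planar operads. A differential graded planar operad (DGPO) over a field $\mathbb{F}$ is a sequence of $\mathbb{N}$-graded chain complexes $O(k)$, $k\in\mathbb{N}$ (arity), with a unit $\iota\in O(1)$ and compositions $\circ_i:O(k)\otimes O(l)\to O(k+l-1)$, $1\le i\le k$, that are chain maps satisfying the usual non-symmetric operad axioms (no symmetric group actions). A GPO is a DGPO with zero differential; it is reduced if $O(0)=0$ and $O(1)=\mathbb{F}\{\iota\}$. A DGPO is formal if it is connected by a zig-zag of quasi-isomorphisms of DGPOs to its homology with zero differential. $\mathcal{F}(V)$ is the free reduced GPO on a sequence of graded vector spaces $V=\{V(i)\}_{i\ge2}$, and $\mathcal{F}(V)=\mathcal{F}^+(V)\oplus V\oplus\mathbb{F}\{\iota\}$ with $\mathcal{F}^+(V)$ spanned by the decomposables. Bigraded model. For a reduced GPO $H$, its bigraded model is a DGPO $(\mathcal{F}(W),d)$, unique up to isomorphism, with a quasi-isomorphism of DGPOs $\rho:(\mathcal{F}(W),d)\to(H,0)$, where $W=\{W^i_j(k)\}$ ($k\ge2$ arity, $j$ dimension, $i\ge0$ level), dimension and level are extended additively to $\mathcal{F}(W)$, $d$ has bidegree $(-1,-1)$ with respect to dimension and level, $W^0=V$ generates $H$ for a presentation $H=\mathcal{F}(V)/(R)$ with $\rho|_V$ the inclusion of generators, $\rho|_{W^i}=0$ for $i>0$, the homology with respect to the level grading satisfies $H^i(\mathcal{F}(W),d)=0$ for $i>0$ and $\rho_*:H^0(\mathcal{F}(W),d)\cong H$, and $d(W)\subset\mathcal{F}^+(W)$.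 Write $W^{\le i}=\oplus_{i'\le i}W^{i'}$. For $H=H_*(D_2,\mathbb{F}_2)$ ($D_2$ the little 2-discs operad with $D_2(0)=\emptyset$), i.e. the Gerstenhaber operad over $\mathbb{F}_2$ with product $x_1x_2$ (degree 0) and bracket $[x_1,x_2]$ (degree 1), considered as a planar operad, the generators $m,b,A,B$ are the following: $m=x_1x_2$ (arity 2, level 0, dimension 0); $b=[x_1,x_2]$ (arity 2, level 0, dimension 1); $A$ (arity 3, level 1, dimension 1) with $d(A)=m\circ_1m+m\circ_2m$; $B$ (arity 3, level 1, dimension 2) with $d(B)=b\circ_1m+b\circ_2m+m\circ_1b+m\circ_2b$. In arity $\le 4$: $W^0$ has basis $m,b,u,l$, where $u=[x_1,x_3][x_2,x_4]$ and $l=[[x_1,x_3],[x_2,x_4]]$ have arity 4 and dimensions 2 and 3; $W^1$ has basis $A,B$; $W^2$ has basis $P,C$, both in arity 4, of dimensions 2 and 3, with $d(P)=m\circ_1 A+m\circ_2 A+A\circ_1 m+A\circ_2 m+A\circ_3 m$ and $d(C)=A\circ_1b+A\circ_2b+A\circ_3b+b\circ_1A+b\circ_2A+B\circ_1m+B\circ_2m+B\circ_3m+m\circ_1B+m\circ_2B$. The map $\partial$. $\mathrm{Hom}_0(W^1,H)$ is the space of linear maps preserving arity and dimension, $\mathrm{Hom}_{-1}(W^2,H)$ the space of linear maps preserving arity and lowering dimension by 1. For $f\in\mathrm{Hom}_0(W^1,H)$, extend $f$ to $W^{\le1}=W^0\oplus W^1$ by $f|_{W^0}=\rho$, let $\hat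 f:\mathcal{F}(W^{\le1})\to H$ be the induced operad map, and set $\partial(f)=\hat f\circ d|_{W^2}$. The operad $S$ (over $\mathbb{F}_2$). $S_i(k)$ has as basis the sequences of length $i+k$ containing all the integers $1,\dots,k$ (and only these), with no two adjacent entries equal and no ordered (not necessarily contiguous) subsequence of the form $abab$ with $a\ne b$. The differential removes one element of the sequence in all possible ways and sums the results, discarding sequences not satisfying these conditions. An interval decomposition of a sequence $y$ into $n$ subsequences is a covering of $y$ by $n$ ordered non-empty subsequences of consecutive elements $y_1,\dots,y_n$, starting at the first and ending at the last entry of $y$, such that $y_i$ and $y_{i+1}$ share exactly one entry position, the last of $y_i$ and the first of $y_{i+1}$. For $x\in S(p)$, $y\in S(q)$ basis sequences, $x\circ_iy\in S(p+q-1)$ is computed as follows: let $n$ be the number of occurrences of $i$ in $x$; add $q-1$ to every value of $x$ larger than $i$; for each interval decomposition $y_1,\dots,y_n$ of $y$, let $y_j'$ be $y_j$ with $i-1$ added to each value, and replace the $j$-th occurrence of $i$ by $y'_j$ for all $j$; sum over all interval decompositions. $\Sigma_k$ acts on $S(k)$ by acting on values. $S$ is weakly equivalent to $C_*(D_2,\mathbb{F}_2)$, and under $H_*(S)\cong H_*(D_2,\mathbb{F}_2)=H$ the product $m$ is represented by $12$ and the bracket $b$ by $121+212$. *)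

(* Defs.v *)
From HB Require Import structures.
From mathcomp Require Import all_boot all_algebra all_fingroup.
From mathcomp Require Import generic_quotient ring_quotient.
From mathcomp Require Import boolp.
From mathcomp Require Import freeg.

Set Implicit Arguments.
Unset Strict Implicit.
Unset Printing Implicit Defensive.

Import GRing.Theory.
Local Open Scope ring_scope.
Local Open Scope quotient_scope.

(** Everything is over 'F_2, so no Koszul signs appear. *)

Section LinearExtension.
Variables (R : nzRingType) (K : choiceType) (M : lmodType R) (f : K -> M).

Lemma fglift_linear : linear (fglift f : {freeg K / R} -> M).
Proof.
have addf : zmod_morphism (fglift f : {freeg K / R} -> M).
  exact: lift_is_additive.
pose addi := GRing.isZmodMorphism.Build _ _ (fglift f) addf.
pose F : {additive {freeg K / R} -> M} := HB.pack (fglift f) addi.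
have sumf (x : {freeg K / R}) : F x = \sum_(z <- dom x) coeff z x *: f z.
  rewrite -{1}[x]freeg_sumE raddf_sum; apply: eq_bigr => z _.
  exact: liftU.
move=> a x y; change (F (a *: x + y) = a *: F x + F y).
rewrite raddfD; congr (_ + _).
have -> : a *: x = \sum_(z <- dom x) << a * coeff z x *g z >> by [].
rewrite raddf_sum sumf scaler_sumr; apply: eq_bigr => z _.
by rewrite scalerA; exact: liftU.
Qed.

HB.instance Definition _ :=
  GRing.isLinear.Build R {freeg K / R} M _ (fglift f) fglift_linear.

End LinearExtension.

Section QuotientModule.
Variables (R : nzRingType) (V : lmodType R) (I : {pred V}).
Hypothesis submodI : submod_closed I.

(* An alias carrying the closure proof, so that [Quotient.quot] applies. *)
Definition submod_pred of submod_closed I : {pred V} := I.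
Local Notation J := (submod_pred submodI).
HB.instance Definition _ := GRing.isSubmodClosed.Build R V J submodI.

Definition quotmod : Type := Quotient.quot J.
HB.instance Definition _ := GRing.Zmodule.on quotmod.

Definition quotmod_pi (x : V) : quotmod := \pi_(Quotient.quot J) x.
Definition quotmod_repr (u : quotmod) : V := repr (u : Quotient.quot J).

Lemma quotmod_reprK u : quotmod_pi (quotmod_repr u) = u.
Proof. exact: (@reprK _ (Quotient.quot J)). Qed.

Lemma quotmod_piE x y : (quotmod_pi x == quotmod_pi y) = (x - y \in I).
Proof. by rewrite -[RHS]/(x - y \in J) (Quotient.idealrBE J). Qed.

Lemma quotmod_piD : {morph quotmod_pi : x y / x + y}.
Proof. by move=> x y; rewrite /quotmod_pi (raddfD \pi_(Quotient.quot J)). Qed.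

Definition quotmod_scale (a : R) (u : quotmod) : quotmod :=
  quotmod_pi (a *: quotmod_repr u).

Lemma quotmod_piZ a x :
  quotmod_scale a (quotmod_pi x) = quotmod_pi (a *: x).
Proof.
apply/eqP; rewrite quotmod_piE -scalerBr -[_ \in I]/(_ \in J) rpredZ //.
by rewrite -[_ \in J]/(_ \in I) -quotmod_piE quotmod_reprK.
Qed.

Lemma quotmod_scaleA a b u :
  quotmod_scale a (quotmod_scale b u) = quotmod_scale (a * b) u.
Proof. by rewrite -[u]quotmod_reprK !quotmod_piZ scalerA. Qed.

Lemma quotmod_scale1 : left_id 1 quotmod_scale.
Proof. by move=> u; rewrite -[u]quotmod_reprK quotmod_piZ scale1r. Qed.

Lemma quotmod_scaleDr : right_distributive quotmod_scale +%R.
Proof.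
move=> a u v; rewrite -[u]quotmod_reprK -[v]quotmod_reprK.
by rewrite -quotmod_piD !quotmod_piZ scalerDr quotmod_piD.
Qed.

Lemma quotmod_scaleDl u : {morph quotmod_scale^~ u : a b / a + b}.
Proof.
move=> a b; rewrite -[u]quotmod_reprK.
by rewrite !quotmod_piZ scalerDl quotmod_piD.
Qed.

HB.instance Definition _ := GRing.Zmodule_isLmodule.Build R quotmod
  quotmod_scaleA quotmod_scale1 quotmod_scaleDr quotmod_scaleDl.

End QuotientModule.

(** [ker d0 / (im d1 :&: ker d0)], for composable linear maps. *)
Section Homology.
Variables (R : nzRingType) (A B C : lmodType R).
Variables (d1 : {linear A -> B}) (d0 : {linear B -> C}).

Definition cycle_pred : {pred B} := [pred x | d0 x == 0].

Lemma cycle_pred_submod : submod_closed cycle_pred.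
Proof.
split=> [|a x y]; rewrite !inE ?linear0 // => /eqP dx /eqP dy.
by rewrite linearP dx dy scaler0 addr0.
Qed.
HB.instance Definition _ :=
  GRing.isSubmodClosed.Build R B cycle_pred cycle_pred_submod.

Definition cycles : Type := {x : B | x \in cycle_pred}.
HB.instance Definition _ := SubChoice.on cycles.
HB.instance Definition _ := [SubChoice_isSubLmodule of cycles by <:].

Definition boundary_pred : {pred cycles} :=
  [pred z : cycles | `[< exists y, d1 y = \val z >]].

Lemma boundary_pred_submod : submod_closed boundary_pred.
Proof.
split=> [|a u v].
  by apply/asboolP; exists 0; rewrite linear0.
move=> /asboolP[x xE] /asboolP[y yE]; apply/asboolP; exists (a *: x + y).
by rewrite linearP xE yE.
Qed.

Definition hgroup : Type := quotmod boundary_pred_submod.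
HB.instance Definition _ := GRing.Lmodule.on hgroup.

(** The junk value at a non-cycle is [0]. *)
Definition hclass (x : B) : hgroup :=
  oapp (fun z : cycles => quotmod_pi boundary_pred_submod z) 0 (insub x).

Definition hrepr (h : hgroup) : B := \val (quotmod_repr h).

End Homology.

(** [ch O k p] is the dimension [p] part of the chain complex [O(k)].
    [circ i x y] is the partial composition of [y] in the [i]-th input of [x];
    it is meaningful for [1 <= i <= k] only.  In dimension [0] the codomain of
    [diff] is again dimension [0]; [is_dgpo] forces it to vanish there. *)
Record opdata := OpData {
  ch : nat -> nat -> lmodType 'F_2;
  opunit : ch 1%N 0%N;
  circ : forall k p l q : nat,
    nat -> ch k p -> ch l q -> ch (k + l).-1 (p + q);
  diff : forall k p : nat, {linear ch k p -> ch k p.-1}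
}.
Arguments opunit {o}.
Arguments circ {o k p l q} i x y.
Arguments diff {o} k p.

(** Homogeneous elements with their arity and dimension: equations between
    elements whose indices agree only propositionally are stated here. *)
Definition homog (O : opdata) : Type :=
  {kp : nat * nat & ch O kp.1 kp.2}.

Definition hom (O : opdata) k p (x : ch O k p) : homog O :=
  existT (fun kp : nat * nat => ch O kp.1 kp.2) (k, p) x.

(** [at_ k p v] is [v] if [v] has arity [k] and dimension [p], else [0]. *)
Definition at_ (O : opdata) k p (v : homog O) : ch O k p :=
  tagged_as (hom (0 : ch O k p)) v.

Record is_dgpo (O : opdata) : Prop := IsDgpo {
  circ_linear_l : forall k p l q i (a : 'F_2) (x x' : ch O k p) (y : ch O l q),
    (1 <= i <= k)%N ->
    circ i (a *: x + x') y = a *: circ i x y + circ i x' y;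
  circ_linear_r : forall k p l q i (a : 'F_2) (x : ch O k p) (y y' : ch O l q),
    (1 <= i <= k)%N ->
    circ i x (a *: y + y') = a *: circ i x y + circ i x y';
  circ_unit_l : forall l q (y : ch O l q), hom (circ 1 opunit y) = hom y;
  circ_unit_r : forall k p i (x : ch O k p), (1 <= i <= k)%N ->
    hom (circ i x opunit) = hom x;
  circ_seq : forall k p l q n r i j
      (x : ch O k p) (y : ch O l q) (z : ch O n r),
    (1 <= i <= k)%N -> (1 <= j <= l)%N ->
    hom (circ (i + j).-1 (circ i x y) z) = hom (circ i x (circ j y z));
  circ_par : forall k p l q n r i j
      (x : ch O k p) (y : ch O l q) (z : ch O n r),
    (1 <= i)%N -> (i < j)%N -> (j <= k)%N ->
    hom (circ (j + l).-1 (circ i x y) z) = hom (circ i (circ j x z) y);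
  diff_dim0 : forall k (x : ch O k 0), diff k 0 x = 0;
  diff_diff : forall k p (x : ch O k p), diff k p.-1 (diff k p x) = 0;
  diff_circ : forall k p l q i (x : ch O k p) (y : ch O l q),
    (1 <= i <= k)%N ->
    diff _ _ (circ i x y) =
      at_ (k + l).-1 (p + q).-1 (hom (circ i (diff k p x) y))
      + at_ (k + l).-1 (p + q).-1 (hom (circ i x (diff l q y)))
}.

(** Morphism of DGPOs defined on the suboperad [D] of [O]. *)
Record dgpo_morph_on (O O' : opdata) (D : forall k p, ch O k p -> Prop)
    (phi : forall k p, ch O k p -> ch O' k p) : Prop := DgpoMorphOn {
  morph_linear : forall k p (a : 'F_2) (x y : ch O k p), D k p x -> D k p y ->
    phi k p (a *: x + y) = a *: phi k p x + phi k p y;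
  morph_unit : phi 1 0 opunit = opunit;
  morph_circ : forall k p l q i (x : ch O k p) (y : ch O l q),
    (1 <= i <= k)%N -> D k p x -> D l q y ->
    phi _ _ (circ i x y) = circ i (phi k p x) (phi l q y);
  morph_diff : forall k p (x : ch O k p), D k p x ->
    phi k p.-1 (diff k p x) = diff k p (phi k p x)
}.

Definition dgpo_morph (O O' : opdata)
    (phi : forall k p, ch O k p -> ch O' k p) : Prop :=
  dgpo_morph_on (fun _ _ _ => True) phi.

(** Bijectivity of the map induced in homology. *)
Definition quasi_iso (O O' : opdata)
    (phi : forall k p, ch O k p -> ch O' k p) : Prop :=
  forall k p,
    (forall x : ch O k p, diff k p x = 0 ->
       (exists y, phi k p x = diff k p.+1 y) ->
       exists z, x = diff k p.+1 z) /\
    (forall y : ch O' k p, diff k p y = 0 ->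
       exists2 x : ch O k p, diff k p x = 0 &
         exists z, phi k p x = y + diff k p.+1 z).

(** The homology of [O] with zero differential.  The composition of two classes
    is the class of the composition of (any) representatives. *)
Definition hcls (O : opdata) k p (x : ch O k p)
    : hgroup (diff (o := O) k p.+1) (diff k p) :=
  hclass (diff k p.+1) (diff k p) x.

Definition homology (O : opdata) : opdata := {|
  ch k p := hgroup (diff (o := O) k p.+1) (diff k p);
  opunit := hcls opunit;
  circ k p l q i a b := hcls (circ i (hrepr a) (hrepr b));
  diff k p := \0%R
|}.

(** Generators are given by bases: [W i j k] is a basis of the vector space of
    generators of level [i], dimension [j] and arity [k]. *)
Definition genfam := nat -> nat -> nat -> Type.

Record gen (W : genfam) := Gen {
  glev : nat; gdim : nat; gar : nat; gval : W glev gdim gar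
}.
Arguments Gen {W glev gdim gar} gval.
HB.instance Definition _ W := gen_eqMixin (gen W).
HB.instance Definition _ W := gen_choiceMixin (gen W).

Inductive ptree (G : Type) := Leaf | Node of G & seq (ptree G).
Arguments Leaf {G}.
HB.instance Definition _ G := gen_eqMixin (ptree G).
HB.instance Definition _ G := gen_choiceMixin (ptree G).

Fixpoint leaves G (t : ptree G) : nat :=
  if t is Node _ ts then sumn (map (@leaves G) ts) else 1%N.

Fixpoint weight G (w : G -> nat) (t : ptree G) : nat :=
  if t is Node g ts then (w g + sumn (map (weight w) ts))%N else 0%N.

Fixpoint all_nodes G (P : pred G) (t : ptree G) : bool :=
  if t is Node g ts then P g && all (all_nodes P) ts else true.

Fixpoint wf_tree (W : genfam) (t : ptree (gen W)) : bool :=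
  if t is Node g ts then (size ts == gar g) && all (@wf_tree W) ts else true.

(** Leaves are numbered from [1], left to right; [graft i t u] replaces the
    [i]-th leaf of [t] by [u]. *)
Fixpoint graft G (i : nat) (t u : ptree G) : ptree G :=
  match t with
  | Leaf => if i == 1%N then u else Leaf
  | Node g ts =>
      Node g ((fix go (i : nat) (ts : seq (ptree G)) : seq (ptree G) :=
                 if ts is s :: ts' then
                   if (i <= leaves s)%N then graft i s u :: ts'
                   else s :: go (i - leaves s)%N ts'
                 else [::]) i ts)
  end.

Definition is_tree (W : genfam) (k p : nat) (t : ptree (gen W)) : bool :=
  [&& wf_tree t, leaves t == k & weight (@gdim W) t == p].

Definition tree (W : genfam) (k p : nat) : choiceType := {t : ptree (gen W) | is_tree k p t}.

Definition freeop (W : genfam) (k p : nat) : lmodType 'F_2 := {freeg (tree W k p) / 'F_2}.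

(** The basis element [t], or [0] if [t] does not have the required indices. *)
Definition tvec (W : genfam) k p (t : ptree (gen W)) : freeop W k p :=
  oapp (fun s : tree W k p => << s >> : freeop W k p) 0 (insub t).

Definition fcirc (W : genfam) k p l q (i : nat) (x : freeop W k p) (y : freeop W l q)
    : freeop W (k + l).-1 (p + q) :=
  fglift (fun s : tree W k p =>
    fglift (fun t : tree W l q =>
      tvec (k + l).-1 (p + q) (graft i (val s) (val t))) y) x.


(* The composition is elaborated before its indices are compared with the
   expected ones: [2 + 1] and [1 + 2] are not to be unified argumentwise. *)
Notation "x 'o_[' i ] y" := (ltac:(let t := constr:(fcirc i x y) in exact t))
  (at level 40, left associativity, only parsing) : ring_scope.
Notation "x 'o_[' i ] y" := (fcirc i x y)
  (at level 40, left associativity, only printing,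
   format "x  'o_[' i ]  y") : ring_scope.

Definition corolla (W : genfam) i j k (w : W i j k) : freeop W k j :=
  tvec k j (Node (Gen w) (nseq k Leaf)).

Definition free_dgpo (W : genfam) (d : forall k p, {linear freeop W k p -> freeop W k p.-1})
    : opdata := {|
  ch := freeop W;
  opunit := tvec 1 0 Leaf;
  circ := @fcirc W;
  diff := d
|}.

(** [x] lies in the span of the trees satisfying [P]. *)
Definition supp (W : genfam) k p (P : pred (ptree (gen W))) (x : freeop W k p) : Prop :=
  forall t, t \in dom x -> P (val t).

Definition in_level (W : genfam) (n : nat) k p (x : freeop W k p) : Prop :=
  supp (fun t => weight (@glev W) t == n) x.

(** The suboperad [F(W^{<= n})] of [F(W)]. *)
Definition in_free_le (W : genfam) (n : nat) k p (x : freeop W k p) : Prop :=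
  supp (all_nodes (fun g => glev g <= n)%N) x.

(** The subspace [F^+(W)] spanned by the decomposables. *)
Definition decomposable (W : genfam) k p (x : freeop W k p) : Prop :=
  supp (fun t => 2 <= weight (fun=> 1%N) t)%N x.

(** The subspace [W^n] of [F(W)]. *)
Definition in_gens (W : genfam) (n : nat) k p (x : freeop W k p) : Prop :=
  supp (fun t => (weight (fun=> 1%N) t == 1%N) && (weight (@glev W) t == n)) x.

(** The operad map [F(W) -> O] induced by an assignment on generators: a node
    with children [t_1, .., t_n] goes to
    [(.. (phi w o_n e(t_n)) .. o_2 e(t_2)) o_1 e(t_1)]. *)
Definition hcirc (O : opdata) (i : nat) (u v : homog O) : homog O :=
  hom (circ i (tagged u) (tagged v)).

Fixpoint tree_eval (W : genfam) (O : opdata) (phi : forall i j k, W i j k -> ch O k j)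
    (t : ptree (gen W)) : homog O :=
  match t with
  | Leaf => hom opunit
  | Node g ts =>
      (fix go (i : nat) (ts : seq (ptree (gen W))) : homog O :=
         if ts is s :: ts' then hcirc i (go i.+1 ts') (tree_eval phi s)
         else hom (phi _ _ _ (gval g))) 1%N ts
  end.

Definition induced_map (W : genfam) (O : opdata) (phi : forall i j k, W i j k -> ch O k j)
    k p (x : freeop W k p) : ch O k p :=
  fglift (fun t : tree W k p => at_ k p (tree_eval phi (val t))) x.

Record bigraded_model (H : opdata) (W : genfam)
    (d : forall k p, {linear freeop W k p -> freeop W k p.-1})
    (rho : forall k p, freeop W k p -> ch H k p) : Prop := BigradedModel {
  bm_arity : forall i j k, W i j k -> (2 <= k)%N;
  bm_dgpo : is_dgpo (free_dgpo d);
  bm_morph : dgpo_morph (O := free_dgpo d) rho;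
  bm_qiso : quasi_iso (O := free_dgpo d) rho;
  bm_level : forall n k p (x : freeop W k p),
    in_level n.+1 x -> in_level n (d k p x);
  bm_level0 : forall k p (x : freeop W k p), in_level 0 x -> d k p x = 0;
  (* [W^0] is a space of generators of [H], included in [H] by [rho] *)
  bm_gens_inj : forall k p (x : freeop W k p),
    in_gens 0 x -> rho k p x = 0 -> x = 0;
  bm_rho_gens : forall i j k (w : W i.+1 j k), rho k j (corolla w) = 0;
  (* level homology: [H^i = 0] for [i > 0], and [rho] induces [H^0 = H] *)
  bm_acyclic : forall n k p (x : freeop W k p),
    in_level n.+1 x -> d k p x = 0 ->
    exists2 y : freeop W k p.+1, in_level n.+2 y & x = d k p.+1 y;
  bm_H0_inj : forall k p (x : freeop W k p),
    in_level 0 x -> rho k p x = 0 ->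
    exists2 y : freeop W k p.+1, in_level 1 y & x = d k p.+1 y;
  bm_H0_surj : forall k p (h : ch H k p),
    exists2 x : freeop W k p, in_level 0 x & rho k p x = h;
  bm_minimal : forall i j k (w : W i j k), decomposable (d k j (corolla w))
}.

Section Obstruction.
Variables (H : opdata) (W : genfam).
Variables (d : forall k p, {linear freeop W k p -> freeop W k p.-1}).
Variables (rho : forall k p, freeop W k p -> ch H k p).

(** Linear maps are given by their values on the basis.  An element of
    [Hom_{-1}] vanishes in dimension [0]. *)
Definition Hom0_W1 : Type := forall j k, (W 1 j k)%N -> ch H k j.
Definition Homm1_W2 : Type := forall j k, (W 2 j.+1 k)%N -> ch H k j.

(** [f] together with [rho] on [W^0]; the value on the levels [>= 2] is
    irrelevant on [F(W^{<= 1})]. *)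
Definition extend_by_rho (f : Hom0_W1) i : forall j k, W i j k -> ch H k j :=
  match i return forall j k, W i j k -> ch H k j with
  | 0 => fun j k w => rho (corolla w)
  | 1 => f
  | _ => fun _ _ _ => 0
  end.

Definition hat (f : Hom0_W1) k p (x : freeop W k p) : ch H k p :=
  induced_map (extend_by_rho f) x.

Definition bdry (f : Hom0_W1) : Homm1_W2 :=
  fun j k w => hat f (d k j.+1 (corolla w)).

Definition in_im_bdry (g : Homm1_W2) : Prop :=
  exists f : Hom0_W1, forall j k (w : (W 2 j.+1 k)%N), bdry f w = g j k w.

(** The element [g + im bdry] of the cokernel. *)
Definition coker_class (g : Homm1_W2) : Homm1_W2 -> Prop :=
  fun g' => exists f : Hom0_W1,
    forall j k (w : (W 2 j.+1 k)%N), g' j k w = g j k w + bdry f w.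

Definition Homm1_zero : Homm1_W2 := fun _ _ _ => 0.

End Obstruction.
Arguments Homm1_zero H W : clear implicits.

(** The map sending [z] in [W^2] to the class of [pi (d z)]. *)
Definition obstruction (O : opdata) (W : genfam)
    (d : forall k p, {linear freeop W k p -> freeop W k p.-1})
    (pi : forall k p, freeop W k p -> ch O k p) : Homm1_W2 (homology O) W :=
  fun j k w => hcls (pi k j (d k j.+1 (corolla w))).

(** Arity [0] is empty, as for the little discs operad without [0]-ary
    operations. *)
Definition is_cactus (k p : nat) (s : seq nat) : bool :=
  [&& (0 < k)%N, size s == (p + k)%N,
      all (mem (iota 1 k)) s, all (mem s) (iota 1 k),
      sorted (fun a b => a != b) s
    & all (fun a => all (fun b => (a != b) ==> ~~ subseq [:: a; b; a; b] s)
                        (iota 1 k)) (iota 1 k)].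

Definition cactus (k p : nat) : choiceType := {s : seq nat | is_cactus k p s}.

Definition Sch (k p : nat) : lmodType 'F_2 := {freeg (cactus k p) / 'F_2}.

(** The basis element [s], or [0] if [s] is not an admissible sequence. *)
Definition cvec (k p : nat) (s : seq nat) : Sch k p :=
  oapp (fun c : cactus k p => << c >> : Sch k p) 0 (insub s).

Definition Sdiff (k p : nat) : {linear Sch k p -> Sch k p.-1} :=
  fglift (fun c : cactus k p =>
    \sum_(n < size (val c)) cvec k p.-1 (take n (val c) ++ drop n.+1 (val c))).

(** The interval decompositions of [y] into [n] pieces; the first piece of
    length [j+1] ends where the next one starts. *)
Fixpoint interval_decs (n : nat) (y : seq nat) : seq (seq (seq nat)) :=
  match n with
  | 0 => [::]
  | 1 => [:: [:: y]]
  | n'.+1 => [seq take j.+1 y :: ys | j <- iota 0 (size y),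
                                      ys <- interval_decs n' (drop j y)]
  end.

(** Replace the [j]-th occurrence of [i] in [x] by the [j]-th piece of [ys]
    shifted by [i - 1], and shift by [l - 1] the values larger than [i]. *)
Fixpoint substitute (i l : nat) (x : seq nat) (ys : seq (seq nat)) : seq nat :=
  match x with
  | [::] => [::]
  | v :: x' =>
      if v == i then
        [seq (a + i).-1 | a <- head [::] ys] ++ substitute i l x' (behead ys)
      else (if (i < v)%N then (v + l).-1 else v) :: substitute i l x' ys
  end.

Definition Scirc k p l q (i : nat) (x : Sch k p) (y : Sch l q)
    : Sch (k + l).-1 (p + q) :=
  fglift (fun s : cactus k p =>
    fglift (fun t : cactus l q =>
      \sum_(ys <- interval_decs (count_mem i (val s)) (val t))
        cvec (k + l).-1 (p + q) (substitute i l (val s) ys)) y) x.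

Definition S : opdata := {|
  ch := Sch;
  opunit := cvec 1 0 [:: 1%N];
  circ := Scirc;
  diff := Sdiff
|}.

(** Action of permutations on the values, which run from [1] to [k]. *)
Definition Sact k p (sigma : {perm 'I_k}) (x : Sch k p) : Sch k p :=
  fglift (fun c : cactus k p =>
    cvec k p [seq oapp (fun a : 'I_k => (sigma a).+1) v (insub v.-1)
             | v <- val c]) x.

(** [x_1 x_2] and [[x_1, x_2]]. *)
Definition prodS : ch S 2 0 := cvec 2 0 [:: 1; 2]%N.
Definition brS : ch S 2 1 := cvec 2 1 [:: 1; 2; 1]%N + cvec 2 1 [:: 2; 1; 2]%N.

(** The transposition exchanging the values [2] and [3]. *)
Definition swap23 : {perm 'I_4} := tperm (inord 1) (inord 2).

(** [[x_1, x_3] [x_2, x_4]] and [[[x_1, x_3], [x_2, x_4]]]. *)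
Definition uS : ch S 4 2 := Sact swap23 (circ 1 (circ 2 prodS brS) brS).
Definition lS : ch S 4 3 := Sact swap23 (circ 1 (circ 2 brS brS) brS).

(* Main.v *)
Require Import Defs.
From mathcomp Require Import all_boot all_algebra.
From mathcomp Require Import boolp freeg.

(** The formula for [d C] is a sum of two brackets, [d C = {A, b} + {B, m}],
    where [{x, y}] is the sum of all the partial compositions of [x] and [y] in
    both orders.  Hence, for every [f],
      [bdry f C = {f A, rho b} + {f B, rho m}]
    is a sum of brackets of homology classes, whereas the obstruction takes at
    [C] the class of [{pi A, pi b} + {pi B, pi m} = {pi B, 12}], in which [pi B]
    is not a cycle.  It therefore suffices to find a linear functional on the
    homology of [S] in arity 4 and dimension 2 which vanishes on all brackets of
    classes of bidegrees (3, 1), (2, 1) and (3, 2), (2, 0), written as (arity,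
    dimension), and which is 1 on the class of [{pi B, 12}].  Both conclusions
    follow by evaluating at [C] alone: the functional is 0 on [bdry f C] for
    every [f], and 1 on the obstruction.

    The functional is given by the cocycle [detect] of [S], a sum of four
    cochains each of which prescribes the subsequences formed by some of the
    letters.  That it is a cocycle is [detect_cocycle].  It vanishes on brackets
    of chains of bidegrees (3, 1) and (2, 1), by [detect_bracket_dim1].  On a
    bracket [{x, y}] of chains of bidegrees (3, 2) and (2, 0) it only depends on
    [d x] and [y], so it vanishes when [x] is a cycle, by [detect_bracket_dim2].
    Its value on [{pi B, 12}] is [detect_bracket_pi].  All four are linear or
    bilinear statements about small complexes, hence finite computations on basis
    sequences.

    Passing to homology uses two facts: the compositions of cycles are cycles
    (the Leibniz rule, again verified on bases, [leibniz_low]), and the unit of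
    the homology operad is neutral on the right ([homology_unit_r]), so that the
    map induced on the free operad sends brackets of generators to brackets of
    classes ([hpairing_bracket]). *)

Set Implicit Arguments.
Unset Strict Implicit.
Unset Printing Implicit Defensive.

Import GRing.Theory.
Local Open Scope ring_scope.

Local Notation hom := Defs.hom.

(** * Chains and cochains on admissible sequences *)

Lemma natr_F2 n : n%:R = (odd n)%:R :> 'F_2.
Proof.
rewrite -{1}[n]odd_double_half natrD -mul2n natrM.
have -> : 2%:R = 0 :> 'F_2 by exact: val_inj.
by rewrite mul0r addr0.
Qed.

Lemma cvec_cactus k p (c : cactus k p) : cvec k p (val c) = << c >>.
Proof. by rewrite /cvec valK. Qed.

Lemma cvec_nil k p s : ~~ is_cactus k p s -> cvec k p s = 0.
Proof. by move=> sN; rewrite /cvec insubN. Qed.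

Lemma fglift_cvec k p (M : lmodType 'F_2) (g : seq nat -> M) s :
  fglift (fun c : cactus k p => g (val c)) (cvec k p s)
    = if is_cactus k p s then g s else 0.
Proof.
case: ifP => sP; last by rewrite cvec_nil ?sP // linear0.
by rewrite -[s]/(val (exist _ s sP : cactus k p)) cvec_cactus liftU scale1r.
Qed.

(** The words in the letters [1, .., k] are enumerated so that statements about
    all the admissible sequences of given arity and dimension can be decided. *)
Fixpoint words (k n : nat) : seq (seq nat) :=
  if n is n'.+1 then [seq a :: w | a <- iota 1 k, w <- words k n'] else [:: [::]].

Lemma mem_words k n s :
  (s \in words k n) = (size s == n) && all (mem (iota 1 k)) s.
Proof.
elim: n s => [|n IHn] [|a s] //=.
  by apply/allpairsP => -[[b w] [_ _]].
rewrite eqSS andbCA -IHn; apply/allpairsP/andP => /=.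
  by case=> -[b w] /= [bk wn [-> ->]].
by case=> ak sn; exists (a, s).
Qed.

Definition cacti k p := [seq s <- words k (p + k) | is_cactus k p s].

Lemma mem_cacti k p s : (s \in cacti k p) = is_cactus k p s.
Proof.
rewrite mem_filter mem_words; apply/andP/idP => [[]//|sP]; split=> //.
by case/and5P: sP => _ -> ->.
Qed.

(** Over ['F_2] every chain is of this form, so that operations on chains are
    computed on lists of sequences. *)
Definition vec k p (L : seq (seq nat)) : Sch k p := \sum_(s <- L) cvec k p s.

Lemma vec_nil k p : vec k p [::] = 0.
Proof. exact: big_nil. Qed.

Lemma vec_cat k p L L' : vec k p (L ++ L') = vec k p L + vec k p L'.
Proof. exact: big_cat. Qed.

Lemma vec_cons k p s L : vec k p (s :: L) = cvec k p s + vec k p L.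
Proof. exact: big_cons. Qed.

Lemma vec1 k p s : vec k p [:: s] = cvec k p s.
Proof. exact: big_seq1. Qed.

Lemma Sch_ind k p (Q : Sch k p -> Prop) :
    Q 0 -> (forall x y, Q x -> Q y -> Q (x + y)) ->
    (forall s, s \in cacti k p -> Q (vec k p [:: s])) ->
  forall x, Q x.
Proof.
move=> Q0 QD Qc x; rewrite -[x]freeg_sumE; apply: (big_ind Q) => // c _.
have [->|/eqP nz] := eqVneq (coeff c x) 0; first by rewrite freegU0.
have -> : coeff c x = 1.
  by apply/val_inj; case: (coeff c x) nz => -[|[|//]] //= ltn []; apply/val_inj.
by rewrite -cvec_cactus -vec1; apply: Qc; rewrite mem_cacti; apply: (valP c).
Qed.

(** The linear functional taking the value [1] exactly at the basis sequences
    satisfying [phi]. *)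
Definition pairing k p (phi : pred (seq nat)) : Sch k p -> ('F_2)^o :=
  fglift (fun c : cactus k p => (phi (val c))%:R : ('F_2)^o).

Lemma pairing0 k p phi : pairing phi (0 : Sch k p) = 0.
Proof. exact: linear0. Qed.

Lemma pairingD k p phi (x y : Sch k p) :
  pairing phi (x + y) = pairing phi x + pairing phi y.
Proof. exact: linearD. Qed.

Lemma pairing_sum k p phi (I : Type) (r : seq I) (x : I -> Sch k p) :
  pairing phi (\sum_(i <- r) x i) = \sum_(i <- r) pairing phi (x i).
Proof. by apply: big_morph; [exact: pairingD | exact: pairing0]. Qed.

Definition parity k p phi (L : seq (seq nat)) : bool :=
  odd (count (predI phi (is_cactus k p)) L).

Lemma pairing_vec k p phi L :
  pairing phi (vec k p L) = (parity k p phi L)%:R :> 'F_2.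
Proof.
rewrite -natr_F2; elim: L => [|s L IHL]; first by rewrite vec_nil pairing0.
rewrite vec_cons pairingD IHL [in RHS]/= natrD; congr (_ + _).
rewrite [LHS](fglift_cvec _ _ (fun s => (phi s)%:R : ('F_2)^o)).
by case: (is_cactus k p s); rewrite ?andbT ?andbF.
Qed.

Lemma pairing_pred0 k p (x : Sch k p) : pairing pred0 x = 0.
Proof.
elim/Sch_ind: x => [|x y IHx IHy|s _]; first exact: pairing0.
  by rewrite pairingD IHx IHy addr0.
by rewrite pairing_vec /parity count_pred0.
Qed.

(** Chains are compared on lists by counting multiplicities modulo 2; sequences
    that are not admissible stand for [0] and may occur with any multiplicity. *)
Definition even_mult k p (L : seq (seq nat)) : bool :=
  all (fun s => is_cactus k p s ==> ~~ odd (count_mem s L)) L.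

Lemma vec_eq0 k p L : even_mult k p L -> vec k p L = 0.
Proof.
move=> /allP evL; apply/eqP/freeg_eqP => c; rewrite coeff0.
have -> : coeff c (vec k p L) = pairing (pred1 (val c)) (vec k p L) by [].
rewrite pairing_vec /parity (@eq_count _ _ (pred1 (val c))) => [|s]; last first.
  by rewrite /=; case: eqP => //= ->; rewrite (valP c).
have [cL|/count_memPn -> //] := boolP (val c \in L).
by have /implyP/(_ (valP c))/negbTE -> := evL _ cL.
Qed.

(** * The differential and the compositions on sequences *)

Definition faces (s : seq nat) : seq (seq nat) :=
  [seq take n s ++ drop n.+1 s | n <- iota 0 (size s)].

Definition inserts (i l : nat) (s t : seq nat) : seq (seq nat) :=
  [seq substitute i l s ys | ys <- interval_decs (count_mem i s) t].

Definition sdiff k p (L : seq (seq nat)) : seq (seq nat) :=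
  flatten [seq faces s | s <- L & is_cactus k p s].

Definition scirc k p l q i (L M : seq (seq nat)) : seq (seq nat) :=
  flatten [seq inserts i l s t | s <- [seq s <- L | is_cactus k p s],
                                 t <- [seq t <- M | is_cactus l q t]].

Lemma Sdiff0 k p : Sdiff k p 0 = 0.
Proof. exact: linear0. Qed.

Lemma SdiffD k p x y : Sdiff k p (x + y) = Sdiff k p x + Sdiff k p y.
Proof. exact: linearD. Qed.

Lemma Sdiff_vec k p L : Sdiff k p (vec k p L) = vec k p.-1 (sdiff k p L).
Proof.
elim: L => [|s L IHL]; first by rewrite !vec_nil Sdiff0.
rewrite vec_cons SdiffD IHL /sdiff /=.
case: ifP => [sP|/negbT sN]; last by rewrite (cvec_nil sN) Sdiff0 add0r.
rewrite /= vec_cat; congr (_ + _).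
rewrite [LHS](fglift_cvec _ _ (fun s =>
  \sum_(n < size s) cvec k p.-1 (take n s ++ drop n.+1 s))) sP.
by rewrite /vec big_map -[in RHS](subn0 (size s)) -/(index_iota 0 _) big_mkord.
Qed.

(** The arity and the dimension of the result are left free.  The three terms of
    the Leibniz rule, whose indices agree only propositionally, then lie in one
    chain group, and so do the two halves of a bracket. *)
Definition compose K N k p l q i (x : Sch k p) (y : Sch l q) : Sch K N :=
  fglift (fun s : cactus k p => fglift (fun t : cactus l q =>
    vec K N (inserts i l (val s) (val t))) y) x.

Lemma ScircE k p l q i (x : Sch k p) (y : Sch l q) :
  Scirc i x y = compose (k + l).-1 (p + q) i x y.
Proof.
rewrite /Scirc /compose; congr fglift; apply/funext => s; congr fglift.
by apply/funext => t; rewrite /vec big_map.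
Qed.

Section Compose.
Variables (K N k p l q i : nat).
Implicit Types (x : Sch k p) (y : Sch l q).
Local Notation compose := (@compose K N k p l q i).

Lemma composeDl x x' y : compose (x + x') y = compose x y + compose x' y.
Proof. exact: linearD. Qed.

Lemma compose0l y : compose 0 y = 0.
Proof. exact: linear0. Qed.

Lemma compose_cvec_l s y : is_cactus k p s ->
  compose (cvec k p s) y
    = fglift (fun t : cactus l q => vec K N (inserts i l s (val t))) y.
Proof.
move=> sP; rewrite [LHS](fglift_cvec _ _ (fun s =>
  fglift (fun t : cactus l q => vec K N (inserts i l s (val t))) y)).
by rewrite sP.
Qed.

Lemma composeDr x y y' : compose x (y + y') = compose x y + compose x y'.
Proof.
elim/Sch_ind: x => [|x x' IHx IHx'|s sP]; first by rewrite !compose0l addr0.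
  by rewrite !composeDl IHx IHx' addrACA.
by rewrite vec1 !compose_cvec_l -?mem_cacti // linearD.
Qed.

Lemma compose0r x : compose x 0 = 0.
Proof. by apply: (addIr (compose x 0)); rewrite -composeDr !add0r. Qed.

Lemma compose_vec L M :
  compose (vec k p L) (vec l q M) = vec K N (scirc k p l q i L M).
Proof.
elim: L => [|s L IHL]; first by rewrite !vec_nil compose0l.
rewrite vec_cons composeDl IHL /scirc /=.
case: ifP => [sP|/negbT sN]; last by rewrite (cvec_nil sN) compose0l add0r.
rewrite /= flatten_cat vec_cat; congr (_ + _).
elim: M {IHL} => [|t M IHM]; first by rewrite !vec_nil compose0r.
rewrite vec_cons composeDr IHM /=.
case: ifP => [tP|/negbT tN]; last by rewrite (cvec_nil tN) compose0r add0r.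
rewrite /= vec_cat compose_cvec_l //; congr (_ + _).
by rewrite (fglift_cvec _ _ (fun t => vec K N (inserts i l s t))) tP.
Qed.

End Compose.

(** Both sides of the Leibniz rule are bilinear, so in given arities and
    dimensions the rule amounts to finitely many equations between lists. *)
Definition leibniz k p l q i : bool :=
  all (fun s => all (fun t =>
      even_mult (k + l).-1 (p + q).-1
        (sdiff (k + l).-1 (p + q) (scirc k p l q i [:: s] [:: t])
         ++ scirc k p.-1 l q i (sdiff k p [:: s]) [:: t]
         ++ scirc k p l q.-1 i [:: s] (sdiff l q [:: t])))
    (cacti l q)) (cacti k p).

Lemma Sdiff_Scirc k p l q i (x : Sch k p) (y : Sch l q) : leibniz k p l q i ->
  Sdiff k p x = 0 -> Sdiff l q y = 0 -> Sdiff _ _ (Scirc i x y) = 0.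
Proof.
move=> /allP leib dx dy; rewrite ScircE.
suff: Sdiff _ _ (compose (k + l).-1 (p + q) i x y)
    + (compose (k + l).-1 (p + q).-1 i (Sdiff k p x) y
       + compose (k + l).-1 (p + q).-1 i x (Sdiff l q y)) = 0.
  by rewrite dx dy compose0l compose0r !addr0.
have addr3ACA (V : zmodType) (a a' b b' c c' : V) :
    a + a' + (b + b' + (c + c')) = a + (b + c) + (a' + (b' + c')).
  by rewrite (addrACA b b') (addrACA a a').
move=> {dx dy}; elim/Sch_ind: x => [|x x' IHx IHx'|s sP].
- by rewrite !compose0l !Sdiff0 compose0l !addr0.
- rewrite composeDl !SdiffD !composeDl addr3ACA.
  by rewrite IHx IHx' addr0.
elim/Sch_ind: y => [|y y' IHy IHy'|t tP].
- by rewrite !compose0r !Sdiff0 compose0r !addr0.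
- rewrite composeDr !SdiffD !composeDr addr3ACA.
  by rewrite IHy IHy' addr0.
rewrite compose_vec !Sdiff_vec !compose_vec -!vec_cat; apply: vec_eq0.
exact: (allP (leib s sP)).
Qed.

Lemma pairing_Sdiff k p phi (x : Sch k p) :
    all (fun s => ~~ parity k p.-1 phi (sdiff k p [:: s])) (cacti k p) ->
  pairing phi (Sdiff k p x) = 0.
Proof.
move=> /allP phid; elim/Sch_ind: x => [|x x' IHx IHx'|s sP].
- by rewrite Sdiff0 pairing0.
- by rewrite SdiffD pairingD IHx IHx' addr0.
by rewrite Sdiff_vec pairing_vec (negbTE (phid s sP)).
Qed.

(** * Brackets *)

(** Modulo 2 this is the commutator of the pre-Lie product given by the sum of
    all partial compositions. *)
Definition bracket K N k p l q (x : Sch k p) (y : Sch l q) : Sch K N :=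
  \sum_(i <- iota 1 k) compose K N i x y + \sum_(i <- iota 1 l) compose K N i y x.

Definition sbracket k p l q (L M : seq (seq nat)) : seq (seq nat) :=
  flatten [seq scirc k p l q i L M | i <- iota 1 k]
  ++ flatten [seq scirc l q k p i M L | i <- iota 1 l].

Lemma bracketDl K N k p l q (x x' : Sch k p) (y : Sch l q) :
  bracket K N (x + x') y = bracket K N x y + bracket K N x' y.
Proof.
rewrite /bracket addrACA -!big_split /=.
congr (_ + _); apply: eq_bigr => i _; first exact: composeDl.
exact: composeDr.
Qed.

Lemma bracketC K N k p l q (x : Sch k p) (y : Sch l q) :
  bracket K N x y = bracket K N y x.
Proof. exact: addrC. Qed.

Lemma bracketDr K N k p l q (x : Sch k p) (y y' : Sch l q) :
  bracket K N x (y + y') = bracket K N x y + bracket K N x y'.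
Proof. by rewrite !(bracketC _ _ x) bracketDl. Qed.

Lemma bracket0l K N k p l q (y : Sch l q) : bracket K N (0 : Sch k p) y = 0.
Proof. by apply: (addIr (bracket K N (0 : Sch k p) y)); rewrite -bracketDl !add0r. Qed.

Lemma bracket0r K N k p l q (x : Sch k p) : bracket K N x (0 : Sch l q) = 0.
Proof. by rewrite bracketC bracket0l. Qed.

Lemma vec_flatten k p (I : Type) (r : seq I) (L : I -> seq (seq nat)) :
  \sum_(i <- r) vec k p (L i) = vec k p (flatten [seq L i | i <- r]).
Proof. by rewrite /vec big_flatten big_map. Qed.

Lemma bracket_vec K N k p l q L M :
  bracket K N (vec k p L) (vec l q M) = vec K N (sbracket k p l q L M).
Proof.
rewrite vec_cat -!vec_flatten.
by congr (_ + _); apply: eq_bigr => i _; rewrite compose_vec.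
Qed.

(** A cochain that is [psi (d x) * chi y] on brackets of basis elements is so on
    all brackets, by bilinearity; in particular it then vanishes on the brackets
    of cycles [x] with arbitrary chains [y]. *)
Lemma pairing_bracket K N k p l q phi psi chi (x : Sch k p) (y : Sch l q) :
    all (fun s => all (fun t =>
        parity K N phi (sbracket k p l q [:: s] [:: t])
          == parity k p.-1 psi (sdiff k p [:: s]) && parity l q chi [:: t])
      (cacti l q)) (cacti k p) ->
  pairing phi (bracket K N x y)
    = pairing psi (Sdiff k p x) * pairing chi y :> 'F_2.
Proof.
move=> /allP chk; elim/Sch_ind: x => [|x x' IHx IHx'|s sP].
- by rewrite bracket0l Sdiff0 !pairing0 mul0r.
- by rewrite bracketDl pairingD IHx IHx' SdiffD (pairingD psi) mulrDl.
elim/Sch_ind: y => [|y y' IHy IHy'|t tP].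
- by rewrite bracket0r !pairing0 mulr0.
- by rewrite bracketDr pairingD IHy IHy' (pairingD chi) mulrDr.
rewrite bracket_vec Sdiff_vec !pairing_vec (eqP (allP (chk s sP) t tP)).
by case: (parity k _ _ _); rewrite ?mul0r ?mul1r.
Qed.

(** * The detecting cocycle *)

Definition restrict (V s : seq nat) : seq nat := [seq a <- s | a \in V].

(** Restriction to the letters in a set [V] forgets the other entries.
    For [V] of size 3 it is a chain map to a complex that is zero in dimension
    3, so every 2-cochain pulls back to a cocycle.  For two complementary pairs
    it is a chain map to a tensor product of complexes that are zero in
    dimensions above 1, so a product of two 1-cochains pulls back to a cocycle.
    Among the cocycles of these two shapes, the following sum of four is selected
    by a linear system: it has to vanish on the brackets of the next lemmas and
    to be [1] on the bracket of [detect_bracket_pi]. *)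
Definition detect : pred (seq nat) := fun s =>
  [&& restrict [:: 1; 2] s == [:: 1; 2; 1]
    & restrict [:: 3; 4] s == [:: 4; 3; 4]]
  (+) [&& restrict [:: 1; 4] s == [:: 1; 4; 1]
        & restrict [:: 2; 3] s == [:: 3; 2; 3]]
  (+) (restrict [:: 1; 2; 3] s == [:: 2; 1; 2; 3; 2])
  (+) (restrict [:: 1; 3; 4] s == [:: 1; 4; 3; 4; 1]).

(** On the bracket of [x] in dimension 2 with [y] in dimension 0, [detect] is
    [bounding (d x)] times the sum of the coefficients of [y]. *)
Definition bounding : pred (seq nat) := fun s =>
  s \in [:: [:: 1; 3; 1; 2]; [:: 3; 1; 2; 1]].

Lemma detect_cocycle (x : Sch 4 3) : pairing detect (Sdiff 4 3 x) = 0.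
Proof. by apply: pairing_Sdiff; vm_compute. Qed.

Lemma detect_bracket_dim1 (x : Sch 3 1) (y : Sch 2 1) :
  pairing detect (bracket 4 2 x y) = 0.
Proof.
rewrite (@pairing_bracket _ _ _ _ _ _ _ pred0 pred0).
  by rewrite pairing_pred0 mul0r.
by vm_compute.
Qed.

Lemma detect_bracket_dim2 (x : Sch 3 2) (y : Sch 2 0) :
  Sdiff 3 2 x = 0 -> pairing detect (bracket 4 2 x y) = 0.
Proof.
move=> dx; rewrite (@pairing_bracket _ _ _ _ _ _ _ bounding predT).
  by rewrite dx pairing0 mul0r.
by vm_compute.
Qed.

(** The first argument is not a cycle, which is why this does not contradict
    [detect_bracket_dim2]. *)
Lemma detect_bracket_pi :
  pairing detect (bracket 4 2
    (vec 3 2 [:: [:: 2; 1; 3; 1; 2]; [:: 2; 3; 1; 3; 2];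
                 [:: 1; 2; 1; 3; 1]; [:: 3; 1; 3; 2; 3]]%N)
    (vec 2 0 [:: [:: 1; 2]%N])) = 1.
Proof.
rewrite bracket_vec pairing_vec.
by rewrite [parity _ _ _ _](_ : _ = true) //; vm_compute.
Qed.

(** The products of cycles used below are cycles; otherwise their classes would
    be junk values. *)
Lemma leibniz_low :
  [/\ all (leibniz 3 1 2 1) (iota 1 3), all (leibniz 2 1 3 1) (iota 1 2),
      all (leibniz 3 2 2 0) (iota 1 3) & all (leibniz 2 0 3 2) (iota 1 2)].
Proof. by split; vm_compute. Qed.

(** * Homology classes *)

Section HomologyClasses.
Variables (R : nzRingType) (A B C : lmodType R).
Variables (d1 : {linear A -> B}) (d0 : {linear B -> C}).
Implicit Types (h : hgroup d1 d0) (x : B).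

Lemma hrepr_cycle h : d0 (hrepr h) = 0.
Proof. exact/eqP/(valP (quotmod_repr h)). Qed.

Lemma hclass_repr h : hclass d1 d0 (hrepr h) = h.
Proof. by rewrite /hclass /hrepr valK /= quotmod_reprK. Qed.

Lemma quotmod_pi_eq (z z' : cycles d0) :
  quotmod_pi (boundary_pred_submod d1 d0) z
    = quotmod_pi (boundary_pred_submod d1 d0) z' ->
  exists y, val z = val z' + d1 y.
Proof.
move/eqP; rewrite quotmod_piE => /asboolP[y dy]; exists y.
by rewrite dy /= addrC subrK.
Qed.

(** Chosen representatives are known only up to boundaries, which is enough to
    evaluate cocycles on them. *)
Lemma hrepr_hclass x : d0 x = 0 -> exists y, hrepr (hclass d1 d0 x) = x + d1 y.
Proof.
move=> dx; have cx : x \in cycle_pred d0 by apply/eqP.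
rewrite /hclass insubT /hrepr /=.
exact: (quotmod_pi_eq (quotmod_reprK _)).
Qed.

Lemma hreprD h h' : exists y, hrepr (h + h') = hrepr h + hrepr h' + d1 y.
Proof.
have := @quotmod_pi_eq (quotmod_repr (h + h')) (quotmod_repr h + quotmod_repr h').
by apply; rewrite quotmod_piD !quotmod_reprK.
Qed.

End HomologyClasses.

(** * Trees with two nodes *)

Lemma at_hom (O : opdata) k p (x : ch O k p) : at_ k p (hom x) = x.
Proof. exact: (@tagged_asE _ _ (hom (0 : ch O k p)) x). Qed.

Section Trees.
Variable W : genfam.

Lemma fglift_tvec k p (M : lmodType 'F_2) (g : ptree (gen W) -> M) t :
  is_tree k p t -> fglift (fun s : tree W k p => g (val s)) (tvec k p t) = g t.
Proof. by move=> tP; rewrite /tvec insubT /= liftU scale1r. Qed.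

Lemma fcirc_tvec k p l q i (t u : ptree (gen W)) :
  is_tree k p t -> is_tree l q u ->
  fcirc i (tvec k p t) (tvec l q u) = tvec (k + l).-1 (p + q) (graft i t u).
Proof.
move=> tP uP.
rewrite [LHS](fglift_tvec (fun t => fglift (fun u : tree W l q =>
  tvec (k + l).-1 (p + q) (graft i t (val u))) (tvec l q u))) //.
by rewrite (fglift_tvec (fun u => tvec (k + l).-1 (p + q) (graft i t u))).
Qed.

Lemma sumn_leaves_nseq n : sumn (map (@leaves (gen W)) (nseq n Leaf)) = n.
Proof. by rewrite map_nseq sumn_nseq mul1n. Qed.

Lemma is_tree_corolla i j k (w : W i j k) :
  is_tree k j (Node (Gen w) (nseq k Leaf)).
Proof.
apply/and3P; split => /=; first by rewrite size_nseq eqxx all_nseq orbT.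
  by rewrite sumn_leaves_nseq.
by rewrite map_nseq sumn_nseq addn0.
Qed.

Lemma graft_corolla (g : gen W) a b u :
  graft a.+1 (Node g (nseq (a + b.+1) Leaf)) u
    = Node g (nseq a Leaf ++ u :: nseq b Leaf).
Proof.
rewrite /=; congr (Node g _).
elim: a => [|a IHa] //=.
by rewrite -IHa subn1.
Qed.

Lemma is_tree_graft_corolla i j a b (w : W i j (a + b.+1)) l q u :
  is_tree l q u ->
  is_tree (a + b.+1 + l).-1 (j + q)
    (Node (Gen w) (nseq a Leaf ++ u :: nseq b Leaf)).
Proof.
move=> /and3P[wfu /eqP lu /eqP wu]; apply/and3P; split => /=.
- rewrite size_cat /= !size_nseq eqxx all_cat /= wfu !all_nseq !orbT //.
- rewrite map_cat sumn_cat /= !sumn_leaves_nseq lu addnS /= -addnA.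
  by rewrite (addnC l).
- by rewrite map_cat sumn_cat /= !map_nseq !sumn_nseq wu addn0.
Qed.

Section Evaluation.
Variables (O : opdata) (phi : forall i j k, W i j k -> ch O k j).
Hypothesis unit_r : forall k p i (x : ch O k p), (1 <= i <= k)%N ->
  hom (circ i x opunit) = hom x.

(** The loop inside [tree_eval], isolated so that it can be reasoned about by
    induction on the list of children. *)
Definition eval_children (x : homog O) :=
  fix go (i : nat) (ts : seq (ptree (gen W))) : homog O :=
    if ts is s :: ts' then hcirc i (go i.+1 ts') (tree_eval phi s) else x.

Lemma eval_children_cons x i t ts :
  eval_children x i (t :: ts)
    = hcirc i (eval_children x i.+1 ts) (tree_eval phi t).
Proof. by []. Qed.

Lemma eval_children_leaves (x : homog O) i n :
  (0 < i)%N -> (i + n <= (tag x).1.+1)%N -> eval_children x i (nseq n Leaf) = x.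
Proof.
case: x => -[k p] x; elim: n i => [//|n IHn] i i0 le /=.
rewrite IHn ?addSn -?addnS //; apply: unit_r.
by rewrite i0 /=; move: le; rewrite /= addnS ltnS; apply/leq_trans/leq_addr.
Qed.

Lemma eval_graft_corolla i j a b (w : W i j (a + b.+1)) i' j' l (w' : W i' j' l.+1) :
  tree_eval phi (Node (Gen w) (nseq a Leaf ++
      Node (Gen w') (nseq l.+1 Leaf) :: nseq b Leaf))
    = hom (circ a.+1 (phi w) (phi w')).
Proof.
rewrite -[LHS]/(eval_children (hom (phi w)) 1 _).
have eval_w' : tree_eval phi (Node (Gen w') (nseq l.+1 Leaf)) = hom (phi w').
  by rewrite -[LHS]/(eval_children (hom (phi w')) 1 (nseq l.+1 Leaf))
    eval_children_leaves.
(* Children are absorbed from the right; [n] counts the leaves left of the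
   grafted corolla that have been absorbed. *)
have step n : (n <= a)%N -> eval_children (hom (phi w)) (a - n).+1
    (nseq n Leaf ++ Node (Gen w') (nseq l.+1 Leaf) :: nseq b Leaf)
    = hom (circ a.+1 (phi w) (phi w')).
  elim: n => [_|n IHn na].
    by rewrite subn0 eval_children_cons eval_w' eval_children_leaves //= addSnnS.
  rewrite eval_children_cons subnSK // IHn ?(ltnW na) //; apply: unit_r.
  rewrite subn_gt0 na /= addnS /=; apply: leq_trans (leq_subr n a) _.
  by rewrite -addnA leq_addr.
by have := step a (leqnn a); rewrite subnn.
Qed.

(** Evaluating a tree with two nodes composes with the unit at each leaf, so only
    the right unit law of [O] is involved. *)
Lemma induced_map_circ i j k (w : W i j k) i' j' l (w' : W i' j' l) n :
    (1 <= n <= k)%N -> (0 < l)%N ->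
  induced_map phi (fcirc n (corolla w) (corolla w')) = circ n (phi w) (phi w').
Proof.
case: n => // a /= ak; case: l w' => // l w' _.
have [b kE] : exists b, k = (a + b.+1)%N.
  by exists (k - a.+1)%N; rewrite addnS -addSn subnKC.
rewrite {}kE in w ak *.
rewrite fcirc_tvec ?is_tree_corolla // graft_corolla.
rewrite [LHS](fglift_tvec (fun t => at_ _ _ (tree_eval phi t))).
  by rewrite eval_graft_corolla at_hom.
by apply: is_tree_graft_corolla; apply: is_tree_corolla.
Qed.

End Evaluation.
End Trees.

(** * The unit of the homology operad *)

Lemma interval_decs1 n a : interval_decs n.+1 [:: a] = [:: nseq n.+1 [:: a]].
Proof. by elim: n => //= n ->. Qed.

Lemma substitute_unit i n (s : seq nat) :
  (count_mem i s <= n)%N -> substitute i 1 s (nseq n [:: 1%N]) = s.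
Proof.
elim: s n => //= v s IHs n; have [->|_] := eqVneq v i.
  by case: n => //= n /IHs ->.
by move=> /IHs ->; case: ifP; rewrite ?addn1.
Qed.

Lemma inserts_unit i s : i \in s -> inserts i 1 s [:: 1%N] = [:: s].
Proof.
rewrite -has_pred1 has_count /inserts; case n_i: (count_mem i s) => [//|n] _.
by rewrite interval_decs1 /map substitute_unit ?n_i.
Qed.

Lemma compose_unit_r k p i (x : Sch k p) :
  (1 <= i <= k)%N -> compose k p i x (cvec 1 0 [:: 1%N]) = x.
Proof.
move=> ik; elim/Sch_ind: x => [|x y IHx IHy|s sP]; first exact: compose0l.
  by rewrite composeDl IHx IHy.
have i_s : i \in s.
  rewrite mem_cacti in sP.
  by case/and5P: sP => _ _ _ /allP + _; apply; rewrite mem_iota add1n ltnS.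
by rewrite -vec1 compose_vec /scirc /= -mem_cacti sP /= inserts_unit.
Qed.

(** There are no admissible sequences of arity 1 and dimension 1, so the class of
    the unit has only one representative. *)
Lemma hrepr_unit : hrepr (opunit : ch (homology S) 1 0) = cvec 1 0 [:: 1%N].
Proof.
have d0 : Sdiff 1 0 (cvec 1 0 [:: 1%N]) = 0.
  by rewrite -vec1 Sdiff_vec vec_eq0.
have [y ->] := hrepr_hclass (Sdiff 1 1) d0.
suff -> : y = 0 by rewrite Sdiff0 addr0.
by elim/Sch_ind: y => // x y -> ->; rewrite addr0.
Qed.

Lemma homology_unit_r k p i (x : ch (homology S) k p) : (1 <= i <= k)%N ->
  hom (circ i x (opunit : ch (homology S) 1 0)) = hom x.
Proof.
move=> ik; rewrite /= hrepr_unit ScircE.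
have : (k + 1).-1 = k by rewrite addn1.
move: (k + 1).-1 (p + 0)%N (addn0 p) => K N -> ->.
by rewrite compose_unit_r // /hcls hclass_repr.
Qed.

(** * Cocycles on homology *)

Definition hpairing k p phi (h : ch (homology S) k p) : ('F_2)^o :=
  pairing phi (hrepr h).

Section HomologyPairing.
Variables (k p : nat) (phi : pred (seq nat)).
Hypothesis phi_cocycle : forall x : Sch k p.+1, pairing phi (Sdiff k p.+1 x) = 0.

Lemma hpairingD (h h' : ch (homology S) k p) :
  hpairing phi (h + h') = hpairing phi h + hpairing phi h'.
Proof.
rewrite /hpairing; have [y ->] := hreprD h h'.
by rewrite 2!pairingD [X in _ + X]phi_cocycle addr0.
Qed.

Lemma hpairing_hcls (x : ch S k p) :
  Sdiff k p x = 0 -> hpairing phi (hcls x) = pairing phi x.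
Proof.
move=> /(hrepr_hclass (Sdiff k p.+1))[y yE].
by rewrite /hpairing /hcls yE pairingD phi_cocycle addr0.
Qed.

End HomologyPairing.

(** * Operad maps on brackets of generators *)

Lemma induced_mapD (W : genfam) (O : opdata) (phi : forall i j k, W i j k -> ch O k j)
    k p (x y : freeop W k p) :
  induced_map phi (x + y) = induced_map phi x + induced_map phi y.
Proof. exact: linearD. Qed.

Section Supports.
Variables (W : genfam) (k p : nat) (Q : pred (ptree (gen W))).

Lemma supp0 : supp Q (0 : freeop W k p).
Proof. by move=> t; rewrite dom0. Qed.

Lemma suppD (x y : freeop W k p) : supp Q x -> supp Q y -> supp Q (x + y).
Proof.
by move=> Qx Qy t /domD_subset; rewrite mem_cat => /orP[/Qx | /Qy].
Qed.

Lemma supp_tvec t : Q t -> supp Q (tvec k p t).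
Proof.
rewrite /tvec; case: insubP => [s _ <- Qs|_ _]; last exact: supp0.
by move=> t'; rewrite domU1 inE => /eqP ->.
Qed.

Lemma supp_sum (I : eqType) (r : seq I) (x : I -> freeop W k p) :
  (forall i, i \in r -> supp Q (x i)) -> supp Q (\sum_(i <- r) x i).
Proof.
move=> Qx; rewrite big_seq; apply: (big_ind (supp Q)) => //.
- exact: supp0.
- exact: suppD.
Qed.

End Supports.

Section FreeBracket.
Variable W : genfam.

(** As for [compose], free indices allow one to add the terms of a bracket. *)
Definition corolla_graft K N n i j k (w : W i j k) i' j' l (w' : W i' j' l) :
    freeop W K N :=
  tvec K N (graft n (Node (Gen w) (nseq k Leaf)) (Node (Gen w') (nseq l Leaf))).

Definition free_bracket K N i j k (w : W i j k) i' j' l (w' : W i' j' l) :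
    freeop W K N :=
  \sum_(n <- iota 1 k) corolla_graft K N n w w'
  + \sum_(n <- iota 1 l) corolla_graft K N n w' w.

Lemma fcirc_corolla n i j k (w : W i j k) i' j' l (w' : W i' j' l) :
  fcirc n (corolla w) (corolla w') = corolla_graft (k + l).-1 (j + j') n w w'.
Proof. exact: fcirc_tvec (is_tree_corolla w) (is_tree_corolla w'). Qed.

End FreeBracket.

Section LevelOne.
Variable W : genfam.

Lemma in_free_le_corolla i j k (w : W i j k) : (i <= 1)%N -> in_free_le 1 (corolla w).
Proof. by move=> i1; apply: supp_tvec; rewrite /= i1 all_nseq orbT. Qed.

Lemma in_free_le_graft K N i j k (w : W i j k) i' j' l (w' : W i' j' l) n :
    (i <= 1)%N -> (i' <= 1)%N -> (1 <= n <= k)%N ->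
  in_free_le 1 (corolla_graft K N n w w').
Proof.
move=> i1 i'1; case: n => // a /= ak; apply: supp_tvec.
have [b kE] : exists b, k = (a + b.+1)%N.
  by exists (k - a.+1)%N; rewrite addnS -addSn subnKC.
rewrite {}kE in w ak *.
by rewrite graft_corolla /= i1 all_cat /= i'1 !all_nseq !orbT.
Qed.

Lemma in_free_le_bracket K N i j k (w : W i j k) i' j' l (w' : W i' j' l) :
  (i <= 1)%N -> (i' <= 1)%N -> in_free_le 1 (free_bracket K N w w').
Proof.
move=> i1 i'1; apply: suppD; apply: supp_sum => n; rewrite mem_iota add1n ltnS;
  exact: in_free_le_graft.
Qed.

Section Morphism.
Variables (d : forall k p, {linear freeop W k p -> freeop W k p.-1}).
Variables (pi : forall k p, freeop W k p -> ch S k p).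
Hypothesis pi_morph : dgpo_morph_on (O := free_dgpo d) (@in_free_le W 1) pi.

Lemma morph_on0 k p : pi (0 : freeop W k p) = 0.
Proof.
have := morph_linear pi_morph 1 (supp0 (p := p) _) (supp0 (k := k) _).
rewrite !scale1r addr0 => pi0; apply: (addIr (pi (0 : freeop W k p))).
by rewrite add0r -pi0.
Qed.

Lemma morph_onD k p (x y : freeop W k p) :
  in_free_le 1 x -> in_free_le 1 y -> pi (x + y) = pi x + pi y.
Proof.
by move=> x1 y1; have := morph_linear pi_morph 1 x1 y1; rewrite !scale1r.
Qed.

Lemma morph_on_sum k p (I : eqType) (r : seq I) (x : I -> freeop W k p) :
    (forall i, i \in r -> in_free_le 1 (x i)) ->
  pi (\sum_(i <- r) x i) = \sum_(i <- r) pi (x i).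
Proof.
elim: r => [|i r IHr] x1; first by rewrite !big_nil morph_on0.
rewrite !big_cons morph_onD ?IHr //.
- by move=> n n_r; apply: x1; rewrite inE n_r orbT.
- by apply: x1; rewrite inE eqxx.
- by apply: supp_sum => n n_r; apply: x1; rewrite inE n_r orbT.
Qed.

Lemma morph_on_graft K N i j k (w : W i j k) i' j' l (w' : W i' j' l) n :
    K = (k + l).-1 -> N = (j + j')%N ->
    (i <= 1)%N -> (i' <= 1)%N -> (1 <= n <= k)%N ->
  pi (corolla_graft K N n w w')
    = compose K N n (pi (corolla w)) (pi (corolla w')).
Proof.
move=> -> -> i1 i'1 nk; rewrite -fcirc_corolla -ScircE.
by apply: (morph_circ pi_morph) => //; apply: in_free_le_corolla.
Qed.

Lemma morph_on_bracket K N i j k (w : W i j k) i' j' l (w' : W i' j' l) :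
    K = (k + l).-1 -> N = (j + j')%N -> (i <= 1)%N -> (i' <= 1)%N ->
  pi (free_bracket K N w w') = bracket K N (pi (corolla w)) (pi (corolla w')).
Proof.
move=> KE NE i1 i'1.
have KE' : K = (l + k).-1 by rewrite addnC.
have NE' : N = (j' + j)%N by rewrite addnC.
have le1 n : n \in iota 1 k -> in_free_le 1 (corolla_graft K N n w w').
  by rewrite mem_iota add1n ltnS; apply: in_free_le_graft.
have le1' n : n \in iota 1 l -> in_free_le 1 (corolla_graft K N n w' w).
  by rewrite mem_iota add1n ltnS; apply: in_free_le_graft.
have -> : pi (free_bracket K N w w')
    = pi (\sum_(n <- iota 1 k) corolla_graft K N n w w')
    + pi (\sum_(n <- iota 1 l) corolla_graft K N n w' w).
  by apply: morph_onD; apply: supp_sum.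
rewrite (morph_on_sum le1) (morph_on_sum le1').
congr (_ + _); apply: eq_big_seq => n; rewrite mem_iota add1n ltnS => nP;
  exact: morph_on_graft.
Qed.

End Morphism.
End LevelOne.

Section HatBracket.
Variables (W : genfam) (phi : forall i j k, W i j k -> ch (homology S) k j).
Variables (K N : nat) (omega : pred (seq nat)).
Hypothesis omega_cocycle :
  forall x : Sch K N.+1, pairing omega (Sdiff K N.+1 x) = 0.

Lemma hpairing_corolla_graft i j k (w : W i j k) i' j' l (w' : W i' j' l) n :
    K = (k + l).-1 -> N = (j + j')%N -> (1 <= n <= k)%N -> (0 < l)%N ->
    leibniz k j l j' n ->
  hpairing omega (induced_map phi (corolla_graft K N n w w'))
    = pairing omega (compose K N n (hrepr (phi w)) (hrepr (phi w'))).
Proof.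
move=> KE NE nk l0 leib; move: omega_cocycle; rewrite {}KE {}NE => omega_cocycle'.
rewrite -fcirc_corolla (induced_map_circ phi homology_unit_r) // -ScircE.
by apply: hpairing_hcls => //; apply: Sdiff_Scirc => //; apply: hrepr_cycle.
Qed.

Lemma hpairing_sum (I : Type) (r : seq I) (x : I -> freeop W K N) :
  hpairing omega (induced_map phi (\sum_(i <- r) x i))
    = \sum_(i <- r) hpairing omega (induced_map phi (x i)).
Proof.
elim: r => [|i r IHr]; last first.
  by rewrite !big_cons induced_mapD (hpairingD omega_cocycle) IHr.
have hp00 := hpairingD omega_cocycle (induced_map phi 0) (induced_map phi 0).
rewrite -induced_mapD addr0 in hp00.
rewrite !big_nil; apply: (addIr (hpairing omega (induced_map phi 0))).
by rewrite add0r; exact: esym hp00.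
Qed.

Lemma hpairing_bracket i j k (w : W i j k) i' j' l (w' : W i' j' l) :
    K = (k + l).-1 -> N = (j + j')%N -> (0 < k)%N -> (0 < l)%N ->
    all (leibniz k j l j') (iota 1 k) -> all (leibniz l j' k j) (iota 1 l) ->
  hpairing omega (induced_map phi (free_bracket K N w w'))
    = pairing omega (bracket K N (hrepr (phi w)) (hrepr (phi w'))).
Proof.
move=> KE NE k0 l0 /allP leib /allP leib'.
have KE' : K = (l + k).-1 by rewrite addnC.
have NE' : N = (j' + j)%N by rewrite addnC.
rewrite induced_mapD (hpairingD omega_cocycle) !hpairing_sum pairingD !pairing_sum.
congr (_ + _); apply: eq_big_seq => n n_in; apply: hpairing_corolla_graft => //.
- by move: n_in; rewrite mem_iota add1n ltnS.
- exact: leib.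
- by move: n_in; rewrite mem_iota add1n ltnS.
- exact: leib'.
Qed.

End HatBracket.

(** * The obstruction *)

Section Obstruction.
Variables (W : genfam) (A : (W 1 1 3)%N) (B : (W 1 2 3)%N).
Variables (m : (W 0 0 2)%N) (b : (W 0 1 2)%N).

Lemma dC_brackets :
  corolla A o_[1] corolla b + corolla A o_[2] corolla b
  + corolla A o_[3] corolla b
  + corolla b o_[1] corolla A + corolla b o_[2] corolla A
  + corolla B o_[1] corolla m + corolla B o_[2] corolla m
  + corolla B o_[3] corolla m
  + corolla m o_[1] corolla B + corolla m o_[2] corolla B
  = free_bracket 4 2 A b + free_bracket 4 2 B m.
Proof.
rewrite !fcirc_corolla /free_bracket /= !big_cons !big_nil !addr0 !addrA.
by [].
Qed.

(** Whatever the values [phi A], [phi b], [phi B], [phi m], they are represented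
    by cycles, and [detect] vanishes on the brackets of those. *)
Lemma hpairing_detect_dC (phi : forall i j k, W i j k -> ch (homology S) k j) :
  hpairing detect
    (induced_map phi (free_bracket 4 2 A b + free_bracket 4 2 B m)) = 0.
Proof.
have [leibAb leibbA leibBm leibmB] := leibniz_low.
rewrite induced_mapD (hpairingD detect_cocycle).
have -> := hpairing_bracket phi detect_cocycle A b erefl erefl isT isT leibAb leibbA.
have -> := hpairing_bracket phi detect_cocycle B m erefl erefl isT isT leibBm leibmB.
have -> := detect_bracket_dim1 (hrepr (phi _ _ _ A)) (hrepr (phi _ _ _ b)).
have -> := detect_bracket_dim2 (hrepr (phi _ _ _ m)) (hrepr_cycle (phi _ _ _ B)).
exact: addr0.
Qed.

End Obstruction.

Theorem theorem5p2
  (* the bigraded model of H = H_*(S) *)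
  (W : genfam)
  (d : forall k p, {linear freeop W k p -> freeop W k p.-1})
  (rho : forall k p, freeop W k p -> ch (homology S) k p)
  (model : bigraded_model d rho)
  (* its generators of arity <= 4 and level <= 2 *)
  (m : (W 0 0 2)%N) (b : (W 0 1 2)%N) (u : (W 0 2 4)%N) (l : (W 0 3 4)%N)
  (A : (W 1 1 3)%N) (B : (W 1 2 3)%N) (P : (W 2 2 4)%N) (C : (W 2 3 4)%N)
  (low_gens : forall i j k (w : W i j k), (i <= 2)%N -> (k <= 4)%N ->
     Gen w \in [:: Gen m; Gen b; Gen u; Gen l; Gen A; Gen B; Gen P; Gen C])
  (rho_m : rho _ _ (corolla m) = hcls prodS)
  (rho_b : rho _ _ (corolla b) = hcls brS)
  (rho_u : rho _ _ (corolla u) = hcls uS)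
  (rho_l : rho _ _ (corolla l) = hcls lS)
  (dA : d _ _ (corolla A) =
     corolla m o_[1] corolla m + corolla m o_[2] corolla m)
  (dB : d _ _ (corolla B) =
     corolla b o_[1] corolla m + corolla b o_[2] corolla m
     + corolla m o_[1] corolla b + corolla m o_[2] corolla b)
  (dP : d _ _ (corolla P) =
     corolla m o_[1] corolla A + corolla m o_[2] corolla A
     + corolla A o_[1] corolla m + corolla A o_[2] corolla m
     + corolla A o_[3] corolla m)
  (dC : d _ _ (corolla C) =
     corolla A o_[1] corolla b + corolla A o_[2] corolla b
     + corolla A o_[3] corolla b
     + corolla b o_[1] corolla A + corolla b o_[2] corolla A
     + corolla B o_[1] corolla m + corolla B o_[2] corolla m
     + corolla B o_[3] corolla m
     + corolla m o_[1] corolla B + corolla m o_[2] corolla B)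
  (* the DGPO morphism (F(W^{<= 1}), d) -> S *)
  (pi : forall k p, freeop W k p -> ch S k p)
  (pi_morph : dgpo_morph_on (O := free_dgpo d) (@in_free_le W 1) pi)
  (pi_cycle : forall j k (w : (W 0 j k)%N), diff k j (pi k j (corolla w)) = 0)
  (pi_rho : forall j k (w : (W 0 j k)%N),
     hcls (pi k j (corolla w)) = rho k j (corolla w))
  (pi_m : pi _ _ (corolla m) = cvec 2 0 [:: 1; 2]%N)
  (pi_b : pi _ _ (corolla b) =
     cvec 2 1 [:: 1; 2; 1]%N + cvec 2 1 [:: 2; 1; 2]%N)
  (pi_A : pi _ _ (corolla A) = 0)
  (pi_B : pi _ _ (corolla B) =
     cvec 3 2 [:: 2; 1; 3; 1; 2]%N + cvec 3 2 [:: 2; 3; 1; 3; 2]%N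
     + cvec 3 2 [:: 1; 2; 1; 3; 1]%N + cvec 3 2 [:: 3; 1; 3; 2; 3]%N) :
  ~ in_im_bdry d rho (obstruction d pi) /\
  coker_class d rho (obstruction d pi)
    <> coker_class d rho (Homm1_zero (homology S) W).
Proof.
have dCE := etrans dC (dC_brackets A B m b).
have brackets_le1 : in_free_le 1 (free_bracket 4 2 A b + free_bracket 4 2 B m).
  by apply: suppD; apply: in_free_le_bracket.
have bdry_C f : hpairing detect (bdry d rho f C) = 0.
  by rewrite /bdry /hat dCE; apply: hpairing_detect_dC.
have obstruction_C : hpairing detect (obstruction d pi C) = 1.
  have cyc : Sdiff 4 2 (pi 4 2 (d 4 3 (corolla C))) = 0.
    have ddC : d 4 2 (d 4 3 (corolla C)) = 0.
      exact: (diff_diff (bm_dgpo model) (corolla C : ch (free_dgpo d) 4 3)).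
    rewrite dCE in ddC *.
    have <- := morph_diff pi_morph brackets_le1.
    rewrite [diff _ _ _]ddC; exact: (morph_on0 pi_morph 4 1).
  rewrite [LHS](hpairing_hcls detect_cocycle cyc) dCE.
  rewrite (morph_onD pi_morph); try exact: in_free_le_bracket.
  rewrite !(morph_on_bracket pi_morph) // pi_A bracket0l add0r pi_B pi_m.
  by rewrite -!vec1 -!vec_cat detect_bracket_pi.
split=> [[f fE]|cokerE].
  by have := bdry_C f; rewrite fE obstruction_C => /eqP; rewrite oner_eq0.
(* Any element [f0] of [Hom_0] will do: equality of the two cosets puts
   [obstruction + bdry f0] in the image of [bdry], although [detect] is [1] on
   its value at [C]. *)
pose f0 : Hom0_W1 (homology S) W := fun _ _ _ => 0.
have [] : coker_class d rho (Homm1_zero (homology S) W)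
    (fun j k w => obstruction d pi w + bdry d rho f0 w).
  by rewrite -cokerE; exists f0.
move=> f /(_ _ _ C) fE.
have := bdry_C f; rewrite /Homm1_zero add0r in fE.
rewrite -fE (hpairingD detect_cocycle) obstruction_C bdry_C addr0 => /eqP.
by rewrite oner_eq0.
Qed.
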